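(* Let $(X,d)$ be a metric space, let $p\in X$, and let $D=X\setminus\{p\}$. Then for all $x,y\in D$, $$\frac12\,\tilde{j}_p(x,y)\le \tau_p(x,y)\le 2\,\tilde{j}_p(x,y).$$ Moreover, both inequalities are sharp for $D=\mathbb{R}^n\setminus\{0\}$ (that is, $X=\mathbb{R}^n$ with the Euclidean metric, $n\ge 2$, and $p=0$): the constant $\frac12$ cannot be replaced by any larger constant and the constant $2$ cannot be replaced by any smaller constant.
   Context: For a metric space $(X,d)$ and $p\in X$, the scale-invariant Cassinian metric on $X\setminus\{p\}$ is $$\tau_p(x,y)=\log\left(1+2\frac{d(x,y)}{\sqrt{d(x,p)\,d(y,p)}}\right),\quad x,y\in X\setminus\{p\}.$$ The distance ratio metric $\tilde{j}$ of $X\setminus\{p\}$ is $$\tilde{j}_p(x,y)=\log\left(1+\frac{d(x,y)}{\min\{d(x,p),d(y,p)\}}\right),\quad x,y\in X\setminus\{p\}.$$ *)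

(* Defs.v *)
(* MathComp-Analysis; R : realType plays the role of the real numbers. *)
From HB Require Import structures.
From mathcomp Require Export all_boot all_order all_algebra.
From mathcomp Require Export boolp reals topology metric_structure exp.
From mathcomp Require Import ring.

Set Implicit Arguments.
Unset Strict Implicit.
Unset Printing Implicit Defensive.

Import Order.TTheory GRing.Theory Num.Theory.
Local Open Scope ring_scope.

Section CassinianMetrics.
Context {R : realType} {X : metricType R}.
Implicit Types p x y : X.

Definition scale_inv_cassinian p x y : R :=
  ln (1 + 2 * (mdist x y / Num.sqrt (mdist x p * mdist y p))).

Definition distance_ratio p x y : R :=
  ln (1 + mdist x y / Num.min (mdist x p) (mdist y p)).

End CassinianMetrics.

(* The metric induced by the library norm on 'rV[R]_n is the sup metric; this
   alias of 'rV[R]_n carries the Euclidean one instead. *)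
Definition euclidean (R : realType) (n : nat) : Type := 'rV[R]_n.

HB.instance Definition _ (R : realType) (n : nat) :=
  GRing.Lmodule.copy (euclidean R n) 'rV[R]_n.

Section EuclideanMetric.
Context {R : realType} {n : nat}.

Definition euclidean_dist (x y : euclidean R n) : R :=
  Num.sqrt (\sum_(i < n) ((x : 'rV[R]_n) 0 i - (y : 'rV[R]_n) 0 i) ^+ 2).

Lemma euclidean_distxx x : euclidean_dist x x = 0.
Proof.
by rewrite /euclidean_dist big1 ?sqrtr0// => i _; rewrite subrr expr0n.
Qed.

Lemma euclidean_dist_positivity x y : euclidean_dist x y = 0 -> x = y.
Proof.
move=> /eqP; rewrite sqrtr_eq0 => le0.
have /eqP : \sum_(i < n) ((x : 'rV[R]_n) 0 i - (y : 'rV[R]_n) 0 i) ^+ 2 = 0.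
  by apply/eqP; rewrite eq_le le0 sumr_ge0// => i _; rewrite sqr_ge0.
rewrite psumr_eq0 => [/allP xy0|i _]; last exact: sqr_ge0.
apply/rowP => i; apply/eqP.
by rewrite -subr_eq0 -sqrf_eq0; apply: (xy0 i); rewrite mem_index_enum.
Qed.

Lemma euclidean_dist_sym x y : euclidean_dist x y = euclidean_dist y x.
Proof.
by congr Num.sqrt; apply: eq_bigr => i _; rewrite -sqrrN opprB.
Qed.

Lemma cauchy_schwarz_sum (a b : 'I_n -> R) :
  (\sum_i a i * b i) ^+ 2 <= (\sum_i a i ^+ 2) * (\sum_i b i ^+ 2).
Proof.
set A := \sum_i a i ^+ 2; set B := \sum_i b i ^+ 2; set C := \sum_i _.
have A0 : 0 <= A by apply: sumr_ge0 => i _; exact: sqr_ge0.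
have key (s t : R) : 0 <= s ^+ 2 * A + 2 * (s * t) * C + t ^+ 2 * B.
  suff -> : s ^+ 2 * A + 2 * (s * t) * C + t ^+ 2 * B
      = \sum_i (s * a i + t * b i) ^+ 2.
    by apply: sumr_ge0 => i _; exact: sqr_ge0.
  rewrite !mulr_sumr -!big_split/=; apply: eq_bigr => i _; ring.
have [A_eq0|A_neq0] := eqVneq A 0.
  suff -> : C = 0 by rewrite A_eq0 mul0r expr0n.
  rewrite /C big1// => i _.
  move/eqP: A_eq0; rewrite psumr_eq0 => [/allP a0|j _]; last exact: sqr_ge0.
  have := a0 i (mem_index_enum i).
  by rewrite /= sqrf_eq0 => /eqP ->; rewrite mul0r.
have Agt0 : 0 < A by rewrite lt_def A_neq0.
rewrite -subr_ge0 -(pmulr_rge0 _ Agt0).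
by have := key (- C) A; congr (0 <= _); ring.
Qed.

Lemma euclidean_dist_triangle y x z :
  euclidean_dist x z <= euclidean_dist x y + euclidean_dist y z.
Proof.
pose a i := (x : 'rV[R]_n) 0 i - (y : 'rV[R]_n) 0 i.
pose b i := (y : 'rV[R]_n) 0 i - (z : 'rV[R]_n) 0 i.
have A0 : 0 <= \sum_i a i ^+ 2 by apply: sumr_ge0 => i _; exact: sqr_ge0.
have B0 : 0 <= \sum_i b i ^+ 2 by apply: sumr_ge0 => i _; exact: sqr_ge0.
rewrite /euclidean_dist -/(a _) -/(b _).
rewrite -(@ler_pXn2r _ 2)// ?nnegrE ?addr_ge0 ?sqrtr_ge0//.
rewrite sqrrD !sqr_sqrtr//; last first.
  by apply: sumr_ge0 => i _; exact: sqr_ge0.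
have -> : \sum_(i < n) ((x : 'rV[R]_n) 0 i - (z : 'rV[R]_n) 0 i) ^+ 2
    = \sum_i a i ^+ 2 + (\sum_i a i * b i) *+ 2 + \sum_i b i ^+ 2.
  rewrite -sumrMnl -!big_split/=; apply: eq_bigr => i _; rewrite /a /b; ring.
rewrite lerD2r lerD2l lerMn2r/= -sqrtrM//.
apply: le_trans (ler_norm _) _.
by rewrite -sqrtr_sqr ler_wsqrtr// cauchy_schwarz_sum.
Qed.

End EuclideanMetric.

HB.instance Definition _ (R : realType) (n : nat) :=
  @isMetric.Build R (euclidean R n) (@euclidean_dist R n)
    (@euclidean_distxx R n) (@euclidean_dist_positivity R n)
    (@euclidean_dist_sym R n) (@euclidean_dist_triangle R n).

Lemma mdist_euclideanE (R : realType) (n : nat) (x y : euclidean R n) :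
  mdist x y = euclidean_dist x y.
Proof. by []. Qed.

(* Main.v *)
(* Write m, M for the smaller and larger of d(x,p), d(y,p), and t = d(x,y).
   As m <= sqrt (m M), the upper bound follows from 1 + 2 t / m <= (1 + t / m)^2;
   as M <= m + t, the lower bound follows from
   t / m = t M / (m M) <= t / sqrt (m M) + t^2 / (m M).
   Both constants are attained asymptotically by pairs u, b u on a ray: 2 as
   b tends to 1, and 1/2 as b tends to infinity. *)
Require Import Defs.
From mathcomp Require Import sequences ring lra.
Import Order.TTheory GRing.Theory Num.Theory.
Local Open Scope ring_scope.

Section Comparison.
Context {R : realType} {X : metricType R}.
Implicit Types p x y : X.

Lemma scale_inv_cassinianC p x y :
  scale_inv_cassinian p x y = scale_inv_cassinian p y x.
Proof.
by rewrite /scale_inv_cassinian (metric_sym x y) (mulrC (mdist x p)).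
Qed.

Lemma distance_ratioC p x y : distance_ratio p x y = distance_ratio p y x.
Proof. by rewrite /distance_ratio (metric_sym x y) minC. Qed.

Lemma scale_inv_cassinian_bounds p x y : x != p -> y != p ->
  1 / 2 * distance_ratio p x y <= scale_inv_cassinian p x y /\
  scale_inv_cassinian p x y <= 2 * distance_ratio p x y.
Proof.
wlog le_xy : x y / mdist x p <= mdist y p => [H xp yp|].
  have [/H|/ltW/H] := leP (mdist x p) (mdist y p); first exact.
  by rewrite scale_inv_cassinianC distance_ratioC; exact.
move=> xp yp; rewrite /scale_inv_cassinian /distance_ratio min_l//.
have a0 : 0 < mdist x p by rewrite mdist_gt0.
have le_b : mdist y p <= mdist x p + mdist x y.
  by rewrite addrC (metric_sym x y); exact: metric_triangle.
have t0 : 0 <= mdist x y by exact: mdist_ge0.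
move: (mdist x p) (mdist y p) (mdist x y) le_xy a0 le_b t0 => a b t.
move=> le_ab a0 le_b t0; have b0 : 0 < b by exact: lt_le_trans le_ab.
set s := Num.sqrt (a * b).
have s2 : s ^+ 2 = a * b by rewrite sqr_sqrtr// ltW// mulr_gt0.
have s0 : 0 < s by rewrite sqrtr_gt0 mulr_gt0.
have le_as : a <= s.
  by rewrite -(@ler_pXn2r _ 2)// ?nnegrE ?(ltW a0) ?(ltW s0)// s2 expr2 ler_pM2l.
have u0 : 0 <= t / s by rewrite divr_ge0// ltW.
have v0 : 0 <= t / a by rewrite divr_ge0// ltW.
have le_uv : t / s <= t / a by rewrite ler_wpM2l// lef_pV2.
have le_vu : t / a <= t / s + (t / s) ^+ 2.
  have -> : t / a = t * b / s ^+ 2 by rewrite s2; field; rewrite !gt_eqF.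
  have -> : t / s + (t / s) ^+ 2 = t * (s + t) / s ^+ 2.
    by field; rewrite gt_eqF.
  by rewrite ler_wpM2r ?invr_ge0 ?sqr_ge0// ler_wpM2l//; lra.
have half_le (z w : R) : z <= 2 * w -> 1 / 2 * z <= w by lra.
have two_ln (z : R) : 0 < z -> 2 * ln z = ln (z ^+ 2).
  by move=> z0; rewrite lnXn// mulr_natl.
(* With [u = t / s] and [v = t / a], what remains is [1 + v <= (1 + 2 * u) ^+ 2], from
   [v <= u + u ^+ 2], and [1 + 2 * u <= (1 + v) ^+ 2], from [u <= v]. *)
split; [apply: half_le|]; rewrite two_ln ?ler_ln ?posrE; nra.
Qed.

End Comparison.

Section Sharpness.
Context {R : realType} {n : nat}.
Local Notation E := (euclidean R n.+1).

Let u : E := delta_mx 0 0 : 'rV[R]_n.+1.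

Let mdist_ray (a b : R) : mdist (a *: u) (b *: u) = `|a - b|.
Proof.
rewrite mdist_euclideanE /euclidean_dist big_ord_recl big1 => [|i _].
  by rewrite !mxE/= !mulr1 addr0 sqrtr_sqr.
by rewrite !mxE/= !mulr0 subrr expr0n.
Qed.

Let ray_neq0 (a : R) : 0 < a -> a *: u != 0.
Proof.
by move=> a0; rewrite -mdist_gt0 -(scale0r u) mdist_ray subr0 normr_gt0 gt_eqF.
Qed.

(** Turns sharpness into a question about functions of the single real variable [b]. *)
Let ray_metrics (b : R) : 1 <= b ->
  scale_inv_cassinian (0 : E) (1 *: u) (b *: u) =
    ln (1 + 2 * ((b - 1) / Num.sqrt b))
  /\ distance_ratio (0 : E) (1 *: u) (b *: u) = ln b.
Proof.
move=> b1; rewrite /scale_inv_cassinian /distance_ratio -(scale0r u) !mdist_ray.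
rewrite !subr0 normr1 mul1r distrC !ger0_norm ?subr_ge0//; last lra.
by rewrite min_l// divr1 [1 + (b - 1)]addrC subrK.
Qed.

Lemma scale_inv_cassinian_lower_sharp (c : R) :
  (forall x y : E, x != 0 -> y != 0 ->
     c * distance_ratio (0 : E) x y <= scale_inv_cassinian (0 : E) x y) ->
  c <= 1 / 2.
Proof.
move=> H; rewrite leNgt; apply/negP => c2.
have ln3 : 0 < ln (3 : R) by rewrite ln_gt0//; lra.
(* Take [b = expR z ^+ 2], so that [sqrt b = expR z]. Then the distance ratio is [2 * z] and the
   Cassinian value is at most [ln 3 + z], which forces [(2 * c - 1) * z <= ln 3]; this [z] makes the
   left side [ln 3 + 1]. *)
pose z := (ln 3 + 1) / (2 * c - 1).
have z0 : 0 < z by rewrite divr_gt0//; lra.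
have zE : (2 * c - 1) * z = ln 3 + 1 by rewrite /z; field; lra.
have k1 : 1 < expR z by rewrite expR_gt1.
have b1 : 1 <= expR z ^+ 2 by rewrite exprn_ege1// ltW.
have b0 : 0 < expR z ^+ 2 by rewrite exprn_gt0// expR_gt0.
have [tauE jE] := ray_metrics _ b1.
have := H _ _ (ray_neq0 _ ltr01) (ray_neq0 _ b0).
rewrite tauE jE sqrtr_sqr gtr0_norm ?expR_gt0//.
rewrite lnXn ?expR_gt0// expRK => le_c.
suff : ln (1 + 2 * ((expR z ^+ 2 - 1) / expR z)) <= ln 3 + z.
  by move: le_c; rewrite -[z *+ 2]mulr_natl; nra.
(* With [k = expR z > 1], this is [1 + 2 * (k - 1 / k) <= 1 + 2 * k <= 3 * k]. *)
rewrite -[in leRHS](expRK z) -lnM ?posrE ?expR_gt0//.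
have le_k : (expR z ^+ 2 - 1) / expR z <= expR z.
  by rewrite ler_pdivrMr ?expR_gt0//; nra.
have ge_k : 0 <= (expR z ^+ 2 - 1) / expR z.
  by rewrite divr_ge0 ?expR_ge0// subr_ge0.
by rewrite ler_ln ?posrE; lra.
Qed.

Lemma scale_inv_cassinian_upper_sharp (C : R) :
  (forall x y : E, x != 0 -> y != 0 ->
     scale_inv_cassinian (0 : E) x y <= C * distance_ratio (0 : E) x y) ->
  2 <= C.
Proof.
move=> H; rewrite leNgt; apply/negP => C2.
(* ln (1 + v) >= v / (1 + v) with v = 2 h / sqrt (1 + h), and ln (1 + h) <= h. *)
have key (h : R) : 0 < h -> 2 * h / (1 + 3 * h) <= C * ln (1 + h).
  move=> h0; have b1 : 1 <= 1 + h by lra.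
  have b0 : 0 < 1 + h by lra.
  have [tauE jE] := ray_metrics _ b1.
  have := H _ _ (ray_neq0 _ ltr01) (ray_neq0 _ b0).
  rewrite tauE jE; apply: le_trans.
  rewrite [1 + h - 1]addrC addKr; set s := Num.sqrt _.
  have s0 : 0 < s by rewrite sqrtr_gt0.
  have s2 : s ^+ 2 = 1 + h by rewrite sqr_sqrtr// ltW.
  have w0 : 0 < 1 + 2 * (h / s).
    by rewrite ltr_pwDl// mulr_ge0// divr_ge0// ltW.
  (* For [w = 1 + 2 * (h / s)], applying [ln (1 + x) <= x] at [x = w^-1 - 1] gives
     [ln w >= 1 - w^-1]. *)
  have inv_gt : -1 < (1 + 2 * (h / s))^-1 - 1 by rewrite ltrBrDr addNr invr_gt0.
  have := le_ln1Dx inv_gt; rewrite addrC subrK lnV ?posrE//.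
  suff : 2 * h / (1 + 3 * h) <= 1 - (1 + 2 * (h / s))^-1 by lra.
  have -> : 1 - (1 + 2 * (h / s))^-1 = 2 * h / (s + 2 * h).
    by field; rewrite !gt_eqF//; lra.
  (* Since [s ^+ 2 = 1 + h >= 1], also [s <= s ^+ 2 = 1 + h], hence [s + 2 * h <= 1 + 3 * h]. *)
  by rewrite ler_wpM2l ?lef_pV2 ?posrE; nra.
have ln_pos (h : R) : 0 < h -> 0 < ln (1 + h) by move=> h0; rewrite ln_gt0; lra.
(* Positivity, read off from [key] at [h = 1], lets [ln (1 + h) <= h] be multiplied by [C]. *)
have C0 : 0 < C.
  rewrite -(pmulr_lgt0 _ (ln_pos 1 ltr01)); apply: lt_le_trans (key 1 ltr01).
  by rewrite divr_gt0//; lra.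
(* The bounds will give [2 <= C * (1 + 3 * h)]. As [0 < C < 2], the right side is below [C + 6 * h],
   which for this [h] is [(2 + C) / 2 < 2]. *)
have [h hE] : {h | h = (2 - C) / 12} by exists ((2 - C) / 12).
have h0 : 0 < h by lra.
have le_h : C * ln (1 + h) <= C * h by rewrite ler_pM2l// le_ln1Dx//; lra.
have := le_trans (key h h0) le_h.
rewrite ler_pdivrMr; last lra.
by rewrite mulrAC ler_pM2r//; nra.
Qed.

End Sharpness.

Theorem theorem3p3 (R : realType) :
  (forall (X : metricType R) (p x y : X), x != p -> y != p ->
     1 / 2 * distance_ratio p x y <= scale_inv_cassinian p x y /\
     scale_inv_cassinian p x y <= 2 * distance_ratio p x y) /\
  (forall n : nat, (2 <= n)%N ->
     (forall c : R,
        (forall x y : euclidean R n, x != 0 -> y != 0 ->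
           c * distance_ratio (0 : euclidean R n) x y <= scale_inv_cassinian (0 : euclidean R n) x y) ->
        c <= 1 / 2) /\
     (forall C : R,
        (forall x y : euclidean R n, x != 0 -> y != 0 ->
           scale_inv_cassinian (0 : euclidean R n) x y <= C * distance_ratio (0 : euclidean R n) x y) ->
        2 <= C)).
Proof.
split=> [X p x y|[//|n] _]; first exact: scale_inv_cassinian_bounds.
split=> [c|C]; first exact: scale_inv_cassinian_lower_sharp.
exact: scale_inv_cassinian_upper_sharp.
Qed.
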